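(* Let $A,B,C,D,E,F,G,H$ be the sets of $3$-subsets of $[10]$ whose multiset of three pairwise cycle distances is, respectively, $\{1,1,2\}$, $\{1,2,3\}$, $\{1,3,4\}$, $\{1,4,5\}$, $\{2,2,4\}$, $\{2,3,5\}$, $\{2,4,4\}$, $\{3,3,4\}$. Let $P_1=A\cup B\cup C\cup H$, $P_2=D\cup E\cup F\cup G$, $P_1'=C\cup D\cup G\cup H$, $P_2'=A\cup B\cup E\cup F$. Then every perfect $2$-coloring of the Johnson graph $J(10,3)$ with quotient matrix $\begin{bmatrix} 12 & 9\\ 9 & 12\end{bmatrix}$ is isomorphic to $\{P_1,P_2\}$ or to $\{P_1',P_2'\}$.
   Context: The Johnson graph $J(10,3)$ has as vertices the $3$-subsets of $[10]=\{1,\dots,10\}$; two vertices $x,y$ are adjacent when $|x\cap y|=2$. A perfect $2$-coloring of $J(10,3)$ with quotient matrix $[p_{i,j}]_{1\le i,j\le 2}$ is a partition of the vertex set into two parts $X_1,X_2$ such that for all $i,j\in\{1,2\}$ every vertex in $X_i$ has exactly $p_{i,j}$ neighbors in $X_j$. The cycle distance between $a,b\in[10]$ is $\min(|a-b|,10-|a-b|)$. Two perfect $2$-colorings (regarded as unordered partitions) are isomorphic if some automorphism of $J(10,3)$, equivalently some permutation of $[10]$ acting on $3$-subsets, maps one partition to the other. *)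

(* Defs.v *)
From mathcomp Require Import all_boot all_order all_fingroup all_algebra.
Set Implicit Arguments.
Unset Strict Implicit.
Unset Printing Implicit Defensive.

Section PerfectColorings.
Variables (T : finType) (e : rel T).

(* The rows and columns of the quotient matrix p are indexed from 0. *)
Definition perfect_2coloring (p : 'M[nat]_2) (X1 X2 : {set T}) : Prop :=
  let X := tnth [tuple X1; X2] in
  [/\ X1 :|: X2 = [set: T],
      [disjoint X1 & X2]
    & forall (i j : 'I_2) (x : T),
        x \in X i -> #|[set y in X j | e x y]| = p i j].

Definition graph_automorphism (f : {perm T}) : Prop :=
  forall x y : T, e (f x) (f y) = e x y.

(* Partitions are sets of parts, so the order of the parts is irrelevant. *)
Definition isomorphic_partitions (P Q : {set {set T}}) : Prop :=
  exists2 f : {perm T},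
    graph_automorphism f & [set f @: (X : {set T}) | X in P] = Q.

End PerfectColorings.

(* The ground set {1, ..., 10} is represented by 'I_10 = {0, ..., 9}; the shift
   does not affect cycle distances. *)
Definition triple : finType := {x : {set 'I_10} | #|x| == 3}.

Definition johnson_adj : rel triple := fun x y => #|val x :&: val y| == 2.

Definition quotient_matrix : 'M[nat]_2 :=
  \matrix_(i < 2, j < 2) (if i == j then 12 else 9).

Definition cycle_dist (a b : 'I_10) : nat := minn `|a - b| (10 - `|a - b|).

(* One entry for each pair a < b of elements of x. *)
Definition cycle_dists (x : {set 'I_10}) : seq nat :=
  [seq cycle_dist ab.1 ab.2
     | ab : 'I_10 * 'I_10 in [pred ab | [&& ab.1 \in x, ab.2 \in x & ab.1 < ab.2]]].

(* perm_eq compares the two lists as multisets. *)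
Definition triples_with_dists (s : seq nat) : {set triple} :=
  [set x : triple | perm_eq (cycle_dists (val x)) s].

Definition classA := triples_with_dists [:: 1; 1; 2].
Definition classB := triples_with_dists [:: 1; 2; 3].
Definition classC := triples_with_dists [:: 1; 3; 4].
Definition classD := triples_with_dists [:: 1; 4; 5].
Definition classE := triples_with_dists [:: 2; 2; 4].
Definition classF := triples_with_dists [:: 2; 3; 5].
Definition classG := triples_with_dists [:: 2; 4; 4].
Definition classH := triples_with_dists [:: 3; 3; 4].

Definition P1 := classA :|: classB :|: classC :|: classH.
Definition P2 := classD :|: classE :|: classF :|: classG.
Definition P1' := classC :|: classD :|: classG :|: classH.
Definition P2' := classA :|: classB :|: classE :|: classF.

(* Main.v *)
Require Import Defs.
From mathcomp Require Import all_boot all_order all_fingroup all_algebra.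
From mathcomp Require Import zify.

(** Let [w(ab) = n(ab) - 4], where [n(ab)] is the number of triples of [X1]
    containing [a] and [b]. Counting the neighbors of a triple [abc] that lie in
    [X1] gives [w(ab) + w(bc) + w(ac) = 3] if [abc] is in [X1] and [-3] otherwise;
    summing over [c] shows that every row of [w] has sum [0].
    The triangle sums force [w] to be constant modulo 3, and, being odd, they
    force the pairs of odd weight to be the pairs inside the two sides of a cut.
    As [-4 <= w <= 4], there are three cases.
    - If 3 divides [w], then [w] is [3] or [-3] inside the sides and [0] across.
      No triangle inside a side is monochromatic, so that both sides have at most
      (hence exactly) 5 points and carry a pentagon and its complement.
    - If [w = 2] modulo 3, then [w] is [-1] inside the sides, and [2] or [-4]
      across; the pairs of weight [-4] form a matching, and the row sums make both
      sides have 5 points and the matching perfect.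
    - If [w = 1] modulo 3, then [- w] is as in the second case.
    So [w] is determined up to a permutation of the points and a sign, and the
    sign exchanges the two parts. *)

Set Implicit Arguments.
Unset Strict Implicit.
Unset Printing Implicit Defensive.
Import GRing.Theory Num.Theory.

(** * Two-colorings of the edges of a complete graph *)

Section Pentagon.

Definition edges5 : seq (nat * nat) :=
  [seq ij <- [seq (i, j) | i <- iota 0 5, j <- iota 0 5] | ij.1 < ij.2].

(* A coloring of the edges of the complete graph on {0, ..., 4} is encoded as the
   list m of the colors of the ten edges, in the order of edges5. *)
Definition edge_bit (m : bitseq) (i j : nat) :=
  nth false m (index (minn i j, maxn i j) edges5).

Definition has_mono_triangle (m : bitseq) :=
  has (fun i => has (fun j => has (fun k =>
    [&& i < j, j < k, edge_bit m i j == edge_bit m j k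
      & edge_bit m j k == edge_bit m i k])
  (iota 0 5)) (iota 0 5)) (iota 0 5).

Definition pentagon_edge (i j : nat) := (i.+1 %% 5 == j) || (j.+1 %% 5 == i).

Definition is_pentagon (m : bitseq) (q : seq nat) :=
  all (fun i => all (fun j =>
    (i == j) || (edge_bit m (nth 0 q i) (nth 0 q j) == pentagon_edge i j))
  (iota 0 5)) (iota 0 5).

Fixpoint bitseqs n : seq bitseq :=
  if n is n'.+1 then
    [seq true :: m | m <- bitseqs n'] ++ [seq false :: m | m <- bitseqs n']
  else [:: [::]].

Lemma mem_bitseqs m : m \in bitseqs (size m).
Proof.
by elim: m => // b m IHm; rewrite mem_cat; case: b; rewrite map_f ?orbT.
Qed.

(** The 1024 colorings are checked by computation. Filtering out those with a monochromatic triangle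
    first keeps the search over permutations to few colorings. *)
Lemma mono_triangle_or_pentagon (m : bitseq) : size m = 10 ->
  has_mono_triangle m || has (is_pentagon m) (permutations (iota 0 5)).
Proof.
move=> m10; case: (boolP (has_mono_triangle m)) => //= mt.
have : m \in [seq m <- bitseqs 10 | ~~ has_mono_triangle m].
  by rewrite mem_filter mt -m10 mem_bitseqs.
by move: m {m10 mt}; apply/allP; vm_compute.
Qed.

Variables (T : eqType) (r : rel T).
Hypothesis rC : symmetric r.

Definition no_mono_triangle (s : seq T) := forall a b c, a \in s -> b \in s -> c \in s ->
  a != b -> b != c -> a != c -> ~ (r a b = r b c /\ r b c = r a c).

(** Carries the computation over to any symmetric relation: [t] runs through [s] along the pentagon
    of related pairs. *)
Lemma no_mono_triangle_pentagon x0 s : uniq s -> size s = 5 -> no_mono_triangle s ->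
  exists t, [/\ uniq t, size t = 5, {subset t <= s} &
    forall i j, i < 5 -> j < 5 -> i != j ->
      r (nth x0 t i) (nth x0 t j) = pentagon_edge i j].
Proof.
move=> us ss tf.
pose v := nth x0 s.
pose m := [seq r (v ij.1) (v ij.2) | ij <- edges5].
have mE i j : i < 5 -> j < 5 -> i != j -> edge_bit m i j = r (v i) (v j).
  have mlt k l : k < l -> l < 5 -> nth false m (index (k, l) edges5) = r (v k) (v l).
    move=> kl l5; have kl5 : (k, l) \in edges5.
      rewrite mem_filter; apply/andP; split=> //; apply/allpairsP; exists (k, l).
      by split=> //; rewrite mem_iota //; apply: ltn_trans l5.
    by rewrite (nth_map (0, 0)) ?nth_index ?index_mem.
  move=> i5 j5; rewrite neq_ltn /edge_bit => /orP[] ij.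
    by rewrite (minn_idPl (ltnW ij)) (maxn_idPr (ltnW ij)) mlt.
  by rewrite (minn_idPr (ltnW ij)) (maxn_idPl (ltnW ij)) mlt.
have vs i : i < 5 -> v i \in s by move=> i5; rewrite mem_nth ?ss.
have vn i j : i < 5 -> j < 5 -> (v i == v j) = (i == j).
  by move=> i5 j5; rewrite nth_uniq ?ss.
case/orP: (mono_triangle_or_pentagon (m := m) (erefl _)).
  case/hasP=> i; rewrite mem_iota => i5 /hasP[j]; rewrite mem_iota => j5.
  case/hasP=> k; rewrite mem_iota => k5 /and4P[ij jk].
  rewrite !mE ?(ltn_eqF ij) ?(ltn_eqF jk) ?(ltn_eqF (ltn_trans ij jk)) //.
  move=> /eqP e1 /eqP e2; case: (tf (v i) (v j) (v k)); rewrite ?vs ?vn //.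
  - by rewrite (ltn_eqF ij).
  - by rewrite (ltn_eqF jk).
  - by rewrite (ltn_eqF (ltn_trans ij jk)).
case/hasP=> q; rewrite mem_permutations => pq pent.
have sq : size q = 5 by rewrite (perm_size pq).
have uq : uniq q by rewrite (perm_uniq pq).
have q5 i : i < 5 -> nth 0 q i < 5.
  move=> i5; have : nth 0 q i \in q by rewrite mem_nth ?sq.
  by rewrite (perm_mem pq) mem_iota.
exists (map v q); split; rewrite ?size_map //.
- rewrite map_inj_in_uniq // => i j; rewrite !(perm_mem pq) !mem_iota /= => i5 j5.
  by move/eqP; rewrite vn // => /eqP.
- by move=> a /mapP[i]; rewrite (perm_mem pq) mem_iota => /= i5 ->; exact: vs.
move=> i j i5 j5 ij; rewrite !(nth_map 0) ?sq // -mE ?q5 ?nth_uniq ?sq //.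
have /allP/(_ i) := pent; rewrite mem_iota => /(_ i5) /allP/(_ j).
by rewrite mem_iota (negbTE ij) => /(_ j5) /eqP.
Qed.

(** This is the Ramsey bound R(3,3) <= 6. With six points, one point [x] is set apart and five
    others form a pentagon. The points related to [x] are pairwise non-adjacent in the pentagon and
    the remaining ones pairwise adjacent, so there are at most two of each kind. *)
Lemma no_mono_triangle_size s : uniq s -> no_mono_triangle s -> size s <= 5.
Proof.
move=> us tf; rewrite leqNgt; apply/negP => s6.
case: s => [//|x s] in us tf s6 *.
have [u5 s5] : uniq (take 5 s) /\ size (take 5 s) = 5.
  by move: us => /= /andP[_ us]; rewrite take_uniq // size_takel.
have tf5 : no_mono_triangle (take 5 s).
  by move=> a b c /mem_take ha /mem_take hb /mem_take hc; apply: tf;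
    rewrite inE ?ha ?hb ?hc orbT.
have [t [ut st ts te]] := no_mono_triangle_pentagon x u5 s5 tf5.
pose v := nth x t.
have vs i : i < 5 -> v i \in s by move=> i5; apply/mem_take/ts/mem_nth; rewrite st.
have xv i : i < 5 -> x != v i.
  move=> i5; apply: contraTneq us => /= ->; by rewrite vs.
have F i j : i < 5 -> j < 5 -> i != j ->
    ~ (r x (v i) = pentagon_edge i j /\ pentagon_edge i j = r x (v j)).
  move=> i5 j5 ij; rewrite -te //.
  apply: tf; rewrite ?inE ?eqxx ?vs ?orbT ?xv //.
  by rewrite nth_uniq ?st.
have := F 0 1; have := F 1 2; have := F 2 3; have := F 3 4; have := F 4 0.
have := F 0 2; have := F 1 3; have := F 2 4; have := F 3 0; have := F 4 1.
rewrite /pentagon_edge /=.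
move: (r x _) (r x _) (r x _) (r x _) (r x _).
by do 5!case; intuition.
Qed.

End Pentagon.

(** * Weights of the pairs *)

Section Counting.
Variable X : {set triple}.

(** Membership in [X] extended to all subsets, false unless the size is 3. Hence in the codegree of
    a pair, the points of the pair itself do not count. *)
Definition hyperedge (s : {set 'I_10}) := s \in [set val x | x in X].

Lemma hyperedge_val (x : triple) : hyperedge (val x) = (x \in X).
Proof. exact: (mem_imset _ _ val_inj). Qed.

Lemma hyperedge_card s : hyperedge s -> #|s| = 3.
Proof. by case/imsetP=> x _ ->; apply/eqP; case: x. Qed.

Definition codegree (e : {set 'I_10}) := #|[set d | hyperedge (d |: e)]|.

Lemma card_johnson_neighbors (x : triple) :
  #|[set y in X | johnson_adj x y]| =
  \sum_(z in val x) #|[set d in ~: val x | hyperedge (d |: val x :\ z)]|.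
Proof.
have sx : #|val x| = 3 by apply/eqP; case: x.
set s := val x in sx *.
(* A neighbor of [x] arises from exactly one exchange of a point [p.1] of [x] for a point [p.2]
   outside. *)
pose f (p : 'I_10 * 'I_10) := p.2 |: s :\ p.1.
pose D := [set p : 'I_10 * 'I_10 |
  [&& p.1 \in s, p.2 \in ~: s & hyperedge (f p)]].
have fz p : p.1 \in s -> p.2 \in ~: s -> s :\: f p = [set p.1].
  case: p => z d; rewrite /f /= inE => zs ds; apply/setP=> i; rewrite !inE.
  case: (eqVneq i z) => [->|_]; rewrite ?zs ?orbF ?andbT /=.
    by apply: contraNneq ds => <-.
  by case: (eqVneq i d) => [->|_]; [exact: negbTE | case: (i \in s)].
have fd p : p.1 \in s -> p.2 \in ~: s -> f p :\: s = [set p.2].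
  case: p => z d; rewrite /f /= inE => zs ds; apply/setP=> i; rewrite !inE.
  case: (eqVneq i d) => [->|_]; first by rewrite ds.
  by case: (i \in s); rewrite ?andbF.
have f_inj : {in D &, injective f}.
  move=> p q; rewrite !inE => /and3P[p1 p2 _] /and3P[q1 q2 _] fpq.
  have := fz p p1; have := fz q q1; have := fd p p1; have := fd q q1.
  rewrite !inE fpq => /(_ q2) -> /(_ p2) /set1_inj e2 /(_ q2) -> /(_ p2) /set1_inj e1.
  by case: p q e1 e2 {p1 p2 q1 q2 fpq} => [? ?] [? ?] /= -> ->.
have im : f @: D = [set val y | y in [set y in X | johnson_adj x y]].
  apply/setP=> t; apply/imsetP/imsetP=> [[p]|[y]].
    rewrite inE => /and3P[p1 p2 /imsetP[y yX fy]] ->; exists y => //.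
    rewrite inE yX /johnson_adj -/s -fy.
    have := cardsID (f p) s; rewrite fz // cards1 sx.
    by rewrite -[3]/(2 + 1) => /addIn ->.
  rewrite inE /johnson_adj -/s => /andP[yX /eqP sy] ->.
  have cy : #|val y| = 3 by apply/eqP; case: (y).
  have /cards1P[z ez] : #|s :\: val y| == 1.
    by have := cardsID (val y) s; lia.
  have /cards1P[d ed] : #|val y :\: s| == 1.
    by have := cardsID s (val y); rewrite setIC; lia.
  have ey : val y = f (z, d).
    apply/setP=> i; move/setP: ez => /(_ i); move/setP: ed => /(_ i).
    rewrite !inE /= => <- <-.
    by case: (i \in s); case: (i \in val y).
  exists (z, d) => //; rewrite !inE /= -ey hyperedge_val yX andbT.
  have /setP/(_ z) := ez; have /setP/(_ d) := ed.
  by rewrite !inE !eqxx => /andP[-> _] /andP[_ ->].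
rewrite -(card_imset _ val_inj) -im card_in_imset // -sum1dep_card.
rewrite (eq_bigr (fun z => \sum_(d in ~: s | hyperedge (f (z, d))) 1)); last first.
  by move=> z _; rewrite -sum1dep_card.
by rewrite pair_big_dep; apply: eq_bigl => p; rewrite andbA.
Qed.

(** The codegree of [val x :\ z] counts the neighbors of [x] that avoid [z], and also [x] itself,
    through [d = z], when [x] is in [X]. The other two points [d] of [x] only give back a pair. So
    [x] is counted once for each of its three points. *)
Lemma card_johnson_neighbors_codegree (x : triple) :
  #|[set y in X | johnson_adj x y]| + 3 * (x \in X) =
  \sum_(z in val x) codegree (val x :\ z).
Proof.
have sx : #|val x| = 3 by apply/eqP; case: x.
have -> : 3 * (x \in X) = \sum_(z in val x) (x \in X).
  by rewrite sum_nat_const sx.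
rewrite card_johnson_neighbors -big_split /=.
apply: eq_bigr => z zx; rewrite /codegree.
rewrite -(cardsID (~: val x) [set d | _]); congr (_ + _).
  by apply: eq_card => d; rewrite !inE andbC.
have -> : [set d | hyperedge (d |: val x :\ z)] :\: ~: val x =
          if x \in X then [set z] else set0.
  apply/setP=> d; rewrite in_setD in_setC negbK inE.
  have [->|dz] := eqVneq d z.
    by rewrite setD1K // hyperedge_val zx; case: ifP; rewrite inE ?eqxx.
  have -> : (d \in if x \in X then [set z] else set0) = false.
    by case: ifP; rewrite !inE ?(negbTE dz).
  apply/andP=> -[dx /hyperedge_card]; rewrite (setUidPr _).
    by move=> c; have := cardsD1 z (val x); rewrite zx c sx.
  by rewrite sub1set !inE dz.
by case: ifP; rewrite ?cards1 ?cards0.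
Qed.

Lemma codegree_le8 a b : a != b -> codegree [set a; b] <= 8.
Proof.
move=> ab; have := cardsC [set a; b]; rewrite cards2 ab card_ord => e.
apply: (@leq_trans #|~: [set a; b]|); last lia.
apply/subset_leq_card/subsetP=> d; rewrite !inE => /hyperedge_card.
by apply: contra_eqN => dab; rewrite (setUidPr _) ?sub1set ?inE // cards2 ab.
Qed.

End Counting.

Local Open Scope ring_scope.

Lemma exists_notin (T : finType) (s : seq T) :
  (size s < #|T|)%N -> exists x, x \notin s.
Proof.
move=> sT; apply/existsP; rewrite -negb_forall; apply: contraL sT => /forallP sT.
by rewrite -leqNgt (leq_trans _ (card_size s)) // subset_leq_card //; apply/subsetP.
Qed.

Section Weight.
Variable X : {set triple}.

(** The codegrees of the pairs in a triple sum to 12 + 3 = 15 or to 9; the shift by 4 makes these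
    sums 3 and -3. *)
Definition weight (a b : 'I_10) : int := (codegree X [set a; b])%:Z - 4.

Lemma weightC a b : weight a b = weight b a.
Proof. by rewrite /weight setUC. Qed.

Lemma weight_bound a b : a != b -> -4 <= weight a b <= 4.
Proof.
by move/(codegree_le8 X); rewrite /weight; move: (codegree _ _) => n; lia.
Qed.

Hypothesis nbX : forall x : triple,
  #|[set y in X | johnson_adj x y]| = if x \in X then 12%N else 9%N.

Lemma weight_triangle a b c : a != b -> b != c -> a != c ->
  weight a b + weight b c + weight a c =
  if hyperedge X (c |: [set a; b]) then 3 else -3.
Proof.
move=> ab bc ac.
have cab : c \notin [set a; b] by rewrite !inE negb_or eq_sym ac eq_sym bc.
have s3 : #|c |: [set a; b]| == 3%N by rewrite cardsU1 cab cards2 ab.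
have := card_johnson_neighbors_codegree X
  (exist (fun s : {set 'I_10} => #|s| == 3%N) _ s3).
rewrite nbX -hyperedge_val /= big_setU1 //= big_setU1 ?inE //= big_set1.
have -> : (c |: [set a; b]) :\ c = [set a; b] by rewrite setU1K.
have -> : (c |: [set a; b]) :\ b = [set a; c].
  by rewrite (setUC [set a]) setUCA setU1K ?(setUC [set c]) // !inE negb_or bc eq_sym ab.
have -> : (c |: [set a; b]) :\ a = [set b; c].
  by rewrite setUCA setU1K ?(setUC [set c]) // !inE negb_or ac ab.
by rewrite /weight; case: ifP => _; lia.
Qed.

(** Let [R u] be the row sum at [u]. The triangle sums on [u], [v] and each of the eight other
    points add up to [R u + R v + 6 * weight u v]. They also add up to 6 times the codegree minus
    24, that is, to [6 * weight u v]. Hence [R u + R v = 0]. *)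
Lemma weight_row a : \sum_(c | c != a) weight a c = 0.
Proof.
pose R u := \sum_(c | c != u) weight u c.
have RR u v : u != v -> R u + R v = 0.
  move=> uv.
  have Rv x y : x != y ->
      R x = weight x y + \sum_(c | (c != x) && (c != y)) weight x c.
    by move=> xy; rewrite /R (bigD1 y) //= eq_sym.
  have c8 : #|[pred c | (c != u) && (c != v)]| = 8%N.
    have := cardsC [set u; v]; rewrite cards2 uv card_ord.
    rewrite [X in (_ + X)%N](_ : _ = #|[pred c | (c != u) && (c != v)]|); last first.
      by apply: eq_card => c; rewrite !inE negb_or.
    by rewrite -[10%N]/(2 + 8)%N => /addnI.
  have hs : (\sum_(c | (c != u) && (c != v)) hyperedge X (c |: [set u; v]))%N
            = codegree X [set u; v].
    rewrite /codegree -sum1dep_card big_mkcond [RHS]big_mkcond /=.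
    apply: eq_bigr => c _; case: (boolP (hyperedge X _)) => [|_]; last by case: ifP.
    move/hyperedge_card => c3; case: ifPn => //.
    by rewrite -negb_or negbK => cuv; move: c3;
      rewrite (setUidPr _) ?cards2 ?uv // sub1set !inE.
  have : \sum_(c | (c != u) && (c != v))
           (weight u v + weight v c + weight u c) = 6 * weight u v.
    rewrite (eq_bigr (fun c => 6 * (hyperedge X (c |: [set u; v]))%:Z - 3)).
      rewrite big_split /= sumr_const c8 -[_ *+ 8]mulr_natr -mulr_sumr.
      rewrite -(big_morph Posz PoszD (erefl _)) hs /weight.
      by move: (codegree _ _) => n; lia.
    move=> c /andP[cu cv]; rewrite weight_triangle // 1?eq_sym //.
    by case: hyperedge.
  rewrite 2!big_split /= sumr_const c8 -[_ *+ 8]mulr_natr.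
  rewrite (Rv u v) // (Rv v u) 1?eq_sym //.
  rewrite (eq_bigl _ _ (fun c => andbC (c != v) (c != u))) (weightC v u).
  by move: (\sum_(_ | _) _) (\sum_(_ | _) _) (weight _ _) => x y z; lia.
(* Row sums that cancel in pairs on three points all vanish. *)
have [b] := @exists_notin 'I_10 [:: a] ltac:(by rewrite card_ord).
have [c] := @exists_notin 'I_10 [:: a; b] ltac:(by rewrite card_ord).
rewrite !inE negb_or eq_sym => /andP[ac bc]; rewrite eq_sym => ab.
have := RR _ _ ab; have := RR _ _ ac; have := RR _ _ bc; rewrite -/(R a); lia.
Qed.
End Weight.

(** * Classification of the weights *)

Definition cyc (i j : nat) : nat := minn `|i - j|%N (10 - `|i - j|)%N.

(* The weights of the pairs at cycle distance 0, ..., 5 for the partitions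
   {P1, P2} and {P1', P2'}; the entry at distance 0 is a dummy. *)
Definition matching_weight (i j : nat) : int :=
  nth 0 [:: 0; 2; -1; 2; -1; -4] (cyc i j).
Definition pentagon_weight (i j : nat) : int :=
  nth 0 [:: 0; 0; -3; 0; 3; 0] (cyc i j).

Lemma all_iota2 n (P : rel nat) :
  all (fun i => all (P i) (iota 0 n)) (iota 0 n) ->
  forall i j, (i < n)%N -> (j < n)%N -> P i j.
Proof.
move=> aP i j ltin ltjn.
by apply: (allP (allP aP i _)); rewrite mem_iota.
Qed.

Section WeightClassification.
Variables (T : finType) (w : T -> T -> int).
Hypothesis cT : #|T| = 10%N.
Hypothesis wC : forall a b, w a b = w b a.
Hypothesis w_triangle : forall a b c, a != b -> b != c -> a != c ->
  w a b + w b c + w a c = 3 \/ w a b + w b c + w a c = -3.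
Hypothesis w_row : forall a, \sum_(c | c != a) w a c = 0.

Lemma weight_mod3 a b c d : a != b -> c != d -> (w a b = w c d %[mod 3])%Z.
Proof.
have step x y z : x != z -> y != z -> (w x z = w y z %[mod 3])%Z.
  move=> xz yz; have [->//|xy] := eqVneq x y.
  have [u] := @exists_notin T [:: x; y; z] ltac:(by rewrite cT).
  rewrite !inE !negb_or !(eq_sym u) => /and3P[xu yu zu].
  have [v] := @exists_notin T [:: x; y; z; u] ltac:(by rewrite cT).
  rewrite !inE !negb_or !(eq_sym v) => /and4P[xv yv zv uv].
  (* The triangles joining x and y to the pairs of points among z, u, v show that
     3 divides 2 (w x z - w y z). *)
  have := w_triangle xz zu xu; have := w_triangle xz zv xv.
  have := w_triangle yz zu yu; have := w_triangle yz zv yv.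
  have := w_triangle xu uv xv; have := w_triangle yu uv yv; lia.
(* The pairs [a b] and [c d] are compared through [c b], which shares a point with each. *)
move=> ab cd; have [cb|cb] := eqVneq c b.
  by rewrite [w c d]wC cb; apply: step; rewrite // -cb eq_sym.
by rewrite (step a c b) // wC [w c d]wC; apply: step; rewrite // eq_sym.
Qed.

(** An odd triangle sum means that one or three sides are odd. So joining each point to a fixed [o]
    decides its class: [p] holds at [o] and at the points whose pair with [o] has odd weight. *)
Lemma weight_parity : exists p : pred T,
  forall a b, a != b -> ((w a b %% 2)%Z == 1) = (p a == p b).
Proof.
have [o _] := @exists_notin T [::] ltac:(by rewrite cT).
exists (fun a => (a == o) || ((w o a %% 2)%Z == 1)) => a b ab.
have [ao|ao] := eqVneq a o.
  by move: ab; rewrite ao [b == o]eq_sym => /negbTE ->; case: (_ == 1).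
have [bo|bo] := eqVneq b o.
  by rewrite bo wC; case: (_ == 1).
have := w_triangle (a := o) _ ab; rewrite !(eq_sym o) => /(_ ao bo) /=; lia.
Qed.

Variable p : pred T.

Lemma card_classes : (#|[pred c | p c == true]| + #|[pred c | p c == false]| = 10)%N.
Proof.
rewrite -cT -(cardC [pred c | p c == true]); congr (_ + _)%N.
by apply: eq_card => c; rewrite !inE eqb_id eqbF_neg.
Qed.

(** * Weights -1 inside the classes, 2 or -4 across *)

Section Matching.
Hypothesis w_same : forall a b, a != b -> p a == p b -> w a b = -1.
Hypothesis w_cross : forall a b, p a != p b -> w a b = 2 \/ w a b = -4.

Let M a := [pred b | (p b != p a) && (w a b == -4)].

(** Two partners of [a] lie in the same class, and would give the triangle sum -4 - 4 - 1 = -9. *)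
Lemma matching_unique a b c : b \in M a -> c \in M a -> b = c.
Proof.
rewrite !inE => /andP[pb /eqP wb] /andP[pc /eqP wc]; apply/eqP/negPn/negP => bc.
have pbc : p b == p c by move: pb pc; case: (p a); case: (p b); case: (p c).
have ab : a != b by apply: contraNneq pb => ->.
have ac : a != c by apply: contraNneq pc => ->.
by case: (w_triangle ab bc ac); rewrite wb wc (w_same bc pbc).
Qed.

(** If the class of [a] has k points and [M a] has m, the row sum is -(k - 1) + 2(10 - k) - 6m =
    0. *)
Lemma card_matching_class a :
  (#|[pred c | p c == p a]| + 2 * #|M a| = 7)%N.
Proof.
pose S := [pred c | p c == p a].
have := w_row a; rewrite (bigID S) /=.
rewrite (eq_bigr (fun=> -1)); last by move=> c /andP[ca pc]; rewrite w_same // eq_sym.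
rewrite sumr_const -mulr_natr.
have -> : \sum_(c | (c != a) && (p c != p a)) w a c =
          \sum_(c | ~~ S c) (2 - 6 * (c \in M a)%:Z).
  apply: eq_big => c.
    by rewrite inE andbC; case: (eqVneq c a) => [->|_]; rewrite ?eqxx ?andbT.
  move=> /andP[ca pc]; rewrite inE pc /=.
  by case: (@w_cross a c) => [|->|->] //; rewrite eq_sym.
rewrite big_split /= sumr_const -[2 *+ _]mulr_natr sumrN -mulr_sumr.
rewrite -(big_morph Posz PoszD (erefl _)).
have -> : (\sum_(c | ~~ S c) (c \in M a) = #|M a|)%N.
  rewrite -sum1_card big_mkcond [RHS]big_mkcond; apply: eq_bigr => c _ /=.
  by rewrite !inE; case: (p c == p a) => //=; case: eqP.
have := cardC S; rewrite cT.
have -> : #|[pred c | (c != a) && (p c == p a)]| = #|S|.-1.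
  rewrite (cardD1 a S) inE eqxx /=; apply: eq_card => c; by rewrite !inE.
have : (0 < #|S|)%N by apply/card_gt0P; exists a; rewrite inE.
have -> : #|[pred c | ~~ S c]| = #|predC S| by apply: eq_card.
move: #|S| #|M a| #|predC S| => x y z; lia.
Qed.

Lemma matching_card_le1 a : (#|M a| <= 1)%N.
Proof. by apply/card_le1_eqP => b c bM cM; rewrite (matching_unique bM cM). Qed.

(** A nonempty class has 7 or 5 points, as [M a] has 0 or 1. Of the sizes 0, 5, 7, only 5 and 5 add
    up to 10. *)
Lemma matching_class_card5 q : #|[pred c | p c == q]| = 5%N.
Proof.
have K q' : (#|[pred c | p c == q']| <= 7)%N.
  case: (posnP #|[pred c | p c == q']|) => [-> //|/card_gt0P[a]].
  by rewrite inE => /eqP <-; have := card_matching_class a; lia.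
have Kc := card_classes; have := K true; have := K false; move: Kc.
have K57 q' : #|[pred c | p c == q']| \in [:: 0; 5; 7]%N.
  case: (posnP #|[pred c | p c == q']|) => [-> //|/card_gt0P[a]].
  rewrite inE => /eqP <-; have := card_matching_class a; have := matching_card_le1 a.
  by case: #|M a| => [|[|//]] _; rewrite !inE; lia.
have := K57 true; have := K57 false; rewrite !inE.
by case: q; move: #|[pred c | p c == true]| #|[pred c | p c == false]| => x y; lia.
Qed.

Lemma matching_exists a : exists b, b \in M a.
Proof.
apply/(card_gt0P (A := M a)); have := card_matching_class a.
by rewrite matching_class_card5; move: #|M a| => n; lia.
Qed.

(** On the 10-cycle, [matching_weight] is -1 at even distances, -4 between antipodes and 2 at
    distances 1 and 3. So the classes go to the two parities and partners go to antipodes. *)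
Lemma matching_labelling : exists2 g : 'I_10 -> T, injective g &
  forall i j, i != j -> w (g i) (g j) = matching_weight i j.
Proof.
pose m a := xchoose (matching_exists a).
have mM a : m a \in M a by exact: xchooseP.
have pm a : p (m a) = ~~ p a.
  by have := mM a; rewrite inE => /andP[]; case: (p _); case: (p _).
have m_inj : injective m.
  move=> a b ab; have pab : p a = p b by apply: negb_inj; rewrite -!pm ab.
  have MC x y : x \in M y -> y \in M x by rewrite !inE wC eq_sym.
  by apply: (@matching_unique (m a)); apply: MC; rewrite // ab.
pose s := enum [pred c | p c == true].
have ss : size s = 5%N by rewrite -cardE matching_class_card5.
have us : uniq s by exact: enum_uniq.
have [x0 _] := @exists_notin T [::] ltac:(by rewrite cT).
have ps k : (k < 5)%N -> p (nth x0 s k).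
  by move=> k5; have := mem_nth x0 (n := k) (s := s); rewrite ss mem_enum inE eqb_id; apply.
(* Even positions list the class of p, position i + 5
   modulo 10 holds the partner of the point at the even position i. *)
pose k (i : nat) := (if odd i then (i + 5) %% 10 else i)./2%N.
pose g (i : 'I_10) := (if odd i then m else id) (nth x0 s (k i)).
have k5 (i : 'I_10) : (k i < 5)%N by rewrite /k; have := ltn_ord i; case: odd; lia.
have pg i : p (g i) = ~~ odd i by rewrite /g; case: odd; rewrite ?pm ps.
have g_inj : injective g.
  move=> i j gij; have oij : odd i = odd j by apply: negb_inj; rewrite -!pg gij.
  have : k i = k j.
    apply/eqP; rewrite -(nth_uniq x0 _ _ us) ?ss //; apply/eqP.
    by move: gij; rewrite /g oij; case: ifP => _ => [/m_inj|].
  move=> kij; apply: val_inj; apply/eqP.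
  have /(_ i j) := @all_iota2 10 (fun i j =>
    (odd i != odd j) || (k i != k j) || (i == j)) (erefl _).
  by rewrite oij kij !eqxx => /(_ (ltn_ord i) (ltn_ord j)).
exists g => // i j ij.
have same (a b : 'I_10) : a != b -> odd a = odd b -> matching_weight a b = -1.
  move=> ab oab.
  have /(_ a b) := @all_iota2 10 (fun i j => (i == j) || (odd i != odd j) ||
      (matching_weight i j == -1)) (erefl _).
  by rewrite (negbTE (ab : a != b :> nat)) oab eqxx => /(_ (ltn_ord a) (ltn_ord b)) /eqP.
have cross (a b : 'I_10) : ~~ odd a -> odd b ->
    w (g a) (g b) = matching_weight a b.
  move=> ea ob; have -> : matching_weight a b = if k a == k b then -4 else 2.
    have /(_ a b) := @all_iota2 10 (fun i j => odd i || ~~ odd j ||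
      (matching_weight i j == if k i == k j then -4 else 2)) (erefl _).
    by rewrite (negbTE ea) ob => /(_ (ltn_ord a) (ltn_ord b)) /eqP.
  have gb : g b = m (nth x0 s (k b)) by rewrite /g ob.
  have ga : g a = nth x0 s (k a) by rewrite /g (negbTE ea).
  have pab : p (g b) != p (g a) by rewrite !pg ob ea.
  case: eqP => [kab|/eqP kab].
    have gab : m (g a) = g b by rewrite ga kab gb.
    by have := mM (g a); rewrite gab inE => /andP[_ /eqP].
  case: (w_cross (a := g a) (b := g b)); first by rewrite eq_sym.
    by [].
  (* Weight -4 would make [g b] the partner of [g a], forcing equal values of [k]. *)
  move=> wab; case/negP: kab; rewrite -(nth_uniq x0 _ _ us) ?ss ?k5 // -ga.
  apply/eqP/m_inj; rewrite -gb.
  by apply: (@matching_unique (g a)); rewrite ?mM // inE pab wab.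
have mwC a b : matching_weight a b = matching_weight b a.
  by rewrite /matching_weight /cyc distnC.
case: (eqVneq (odd i) (odd j)) => oij.
  by rewrite same // w_same ?pg ?oij // (inj_eq g_inj).
case: (boolP (odd i)) oij => [oi|ei]; case: (boolP (odd j)) => [oj|ej] // _.
  by rewrite wC mwC cross.
exact: cross.
Qed.

End Matching.

(** * Weights 3 or -3 inside the classes, 0 across *)

Section PentagonPair.
Hypothesis w_same : forall a b, a != b -> p a == p b -> w a b = 3 \/ w a b = -3.
Hypothesis w_cross : forall a b, p a != p b -> w a b = 0.

Let r a b := w a b == -3.

(** Three equal weights would sum to 9 or -9. *)
Lemma class_no_mono_triangle q : no_mono_triangle r (enum [pred c | p c == q]).
Proof.
move=> a b c; rewrite !mem_enum !inE => /eqP pa /eqP pb /eqP pc ab bc ac [].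
have := w_same ac; have := w_same bc; have := w_same ab.
rewrite pa pb pc eqxx /r => /(_ isT) wab /(_ isT) wbc /(_ isT) wac.
by have := w_triangle ab bc ac; lia.
Qed.

Lemma pentagon_class_card5 q : size (enum [pred c | p c == q]) = 5%N.
Proof.
have rC : symmetric r by move=> a b; rewrite /r wC.
have K q' := no_mono_triangle_size rC (enum_uniq _) (class_no_mono_triangle (q := q')).
have := K true; have := K false; have := card_classes; rewrite -!cardE.
by case: q; move: #|[pred c | p c == true]| #|[pred c | p c == false]| => x y; lia.
Qed.

(** The pentagons of weight -3 in the two classes are laid out in cyclic order on the even and on
    the odd positions. Pentagon edges then have cycle distance 2, the other pairs of a class
    distance 4, and pairs across odd distance. *)
Lemma pentagon_labelling : exists2 g : 'I_10 -> T, injective g &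
  forall i j, i != j -> w (g i) (g j) = pentagon_weight i j.
Proof.
have rC : symmetric r by move=> a b; rewrite /r wC.
have [x0 _] := @exists_notin T [::] ltac:(by rewrite cT).
have P q := no_mono_triangle_pentagon rC x0 (enum_uniq _)
  (pentagon_class_card5 q) (class_no_mono_triangle (q := q)).
have [t1 [ut1 st1 ts1 tr1]] := P true; have [t0 [ut0 st0 ts0 tr0]] := P false.
pose t b := if b then t1 else t0.
have tq q : [/\ uniq (t q), size (t q) = 5%N, forall a, a \in t q -> p a = q &
    forall i j, (i < 5)%N -> (j < 5)%N -> i != j ->
      r (nth x0 (t q) i) (nth x0 (t q) j) = pentagon_edge i j].
  by case: q; split=> // a; [move/ts1 | move/ts0]; rewrite mem_enum inE => /eqP.
pose g (i : 'I_10) := nth x0 (t (odd i)) i./2.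
have k5 (i : 'I_10) : (i./2 < 5)%N by have := ltn_ord i; lia.
have pg i : p (g i) = odd i.
  by have [_ st + _] := tq (odd i); apply; rewrite mem_nth ?st.
have g_inj : injective g.
  move=> i j gij; have oij : odd i = odd j by rewrite -!pg gij.
  apply: val_inj; rewrite /= -(odd_double_half i) -(odd_double_half j) oij.
  have [ut st _ _] := tq (odd j).
  by move/eqP: gij; rewrite /g oij nth_uniq ?st // => /eqP ->.
exists g => // i j ij.
have /(_ i j) := @all_iota2 10 (fun i j => (i == j) || (pentagon_weight i j ==
  if odd i != odd j then 0 else if pentagon_edge i./2 j./2 then -3 else 3)) (erefl _).
rewrite (negbTE (ij : i != j :> nat)) => /(_ (ltn_ord i) (ltn_ord j)) /eqP ->.
case: (eqVneq (odd i) (odd j)) => oij; last by rewrite w_cross ?pg.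
have [_ _ _ /(_ i./2 j./2 (k5 i) (k5 j)) tr] := tq (odd i).
have kij : i./2 != j./2.
  apply: contraNneq ij => kij; apply/eqP/val_inj.
  by rewrite /= -(odd_double_half i) -(odd_double_half j) oij kij.
rewrite /= -tr // /g -oij -/(t _) /r.
by case: (@w_same (g i) (g j)); rewrite ?(inj_eq g_inj) ?pg ?oij // /g -oij => ->.
Qed.

End PentagonPair.
End WeightClassification.

Lemma weight_classification (T : finType) (w : T -> T -> int) :
  #|T| = 10%N -> (forall a b, w a b = w b a) ->
  (forall a b, a != b -> -4 <= w a b <= 4) ->
  (forall a b c, a != b -> b != c -> a != c ->
    w a b + w b c + w a c = 3 \/ w a b + w b c + w a c = -3) ->
  (forall a, \sum_(c | c != a) w a c = 0) ->
  exists2 g : 'I_10 -> T, injective g &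
    [\/ forall i j, i != j -> w (g i) (g j) = pentagon_weight i j,
         forall i j, i != j -> w (g i) (g j) = matching_weight i j |
         forall i j, i != j -> w (g i) (g j) = - matching_weight i j].
Proof.
move=> cT wC wb wt wr.
have [p wp] := weight_parity cT wC wt.
have [a _] := @exists_notin T [::] ltac:(by rewrite cT).
have [b] := @exists_notin T [:: a] ltac:(by rewrite cT).
rewrite inE => ba.
have w3 c d (cd : c != d) := weight_mod3 cT wC wt cd ba.
(* Between -4 and 4, the residues 0, 1, 2 leave {-3, 0, 3}, {-2, 1, 4} and {-4, -1, 2}; odd values
   occur inside the classes, even ones across. *)
have : (w b a %% 3)%Z = 0 \/ (w b a %% 3)%Z = 1 \/ (w b a %% 3)%Z = 2 by lia.
case=> [r|[r|r]].
- have [c d cd|c d cd|g gi gw] := @pentagon_labelling T w cT wC wt p.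
  + have := wp _ _ cd; have := wb _ _ cd; have := w3 _ _ cd.
    by rewrite r; case: (p c == p d) => //; lia.
  + have cd' : c != d by apply: contraNneq cd => ->.
    have := wp _ _ cd'; have := wb _ _ cd'; have := w3 _ _ cd'.
    by rewrite r (negbTE cd); lia.
  by exists g => //; constructor 1.
- pose w' c d := - w c d.
  have [|||c d cd|c d cd|g gi gw] := @matching_labelling T w' cT _ _ _ p.
  + by move=> c d; rewrite /w' wC.
  + by move=> c d e cd de ce; rewrite /w'; have := wt _ _ _ cd de ce; lia.
  + by move=> c; rewrite /w' sumrN wr oppr0.
  + have := wp _ _ cd; have := wb _ _ cd; have := w3 _ _ cd.
    by rewrite r /w'; case: (p c == p d) => //; lia.
  + have cd' : c != d by apply: contraNneq cd => ->.
    have := wp _ _ cd'; have := wb _ _ cd'; have := w3 _ _ cd'.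
    by rewrite r /w' (negbTE cd); lia.
  by exists g => //; constructor 3 => i j ij; rewrite -gw // opprK.
- have [c d cd|c d cd|g gi gw] := @matching_labelling T w cT wC wt wr p.
  + have := wp _ _ cd; have := wb _ _ cd; have := w3 _ _ cd.
    by rewrite r; case: (p c == p d) => //; lia.
  + have cd' : c != d by apply: contraNneq cd => ->.
    have := wp _ _ cd'; have := wb _ _ cd'; have := w3 _ _ cd'.
    by rewrite r (negbTE cd); lia.
  by exists g => //; constructor 2.
Qed.

(** * Recovering the partition *)

Lemma triple_set3 (x : triple) : exists a b c,
  [/\ a != b, b != c, a != c & val x = c |: [set a; b]].
Proof.
have /eqP sx : #|val x| == 3%N by case: x.
have [c cx] : exists c, c \in val x by apply/card_gt0P; rewrite sx.
have /cards2P[a [b [ab e]]] : #|val x :\ c| == 2%N.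
  by have := cardsD1 c (val x); rewrite cx sx -[3%N]/(true + 2)%N => /addnI <-.
have /setD1P[ac _] : a \in val x :\ c by rewrite e !inE eqxx.
have /setD1P[bc _] : b \in val x :\ c by rewrite e !inE eqxx orbT.
by exists a, b, c; split=> //; rewrite 1?eq_sym // -e setD1K.
Qed.

Definition dists3 (i j k : nat) := [:: cyc i j; cyc j k; cyc i k].

Lemma cycle_dists_set3 (a b c : 'I_10) : a != b -> b != c -> a != c ->
  perm_eq (cycle_dists (c |: [set a; b])) (dists3 a b c).
Proof.
move=> ab bc ac.
(* Only increasing pairs enter [cycle_dists], so each pair is sorted first. *)
pose o (x y : 'I_10) := if (x < y)%N then (x, y) else (y, x).
have oE x y : cycle_dist (o x y).1 (o x y).2 = cyc x y.
  by rewrite /o; case: ifP => //= _; rewrite /cycle_dist distnC.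
have -> : dists3 a b c =
    [seq cycle_dist xy.1 xy.2 | xy <- [:: o a b; o b c; o a c]].
  by rewrite /= !oE.
apply/perm_map/uniq_perm; first exact: enum_uniq.
  rewrite /= !inE !negb_or /o andbT.
  move: ab bc ac; rewrite -!val_eqE /=.
  by do 3 case: ifP => _; rewrite !xpair_eqE -!val_eqE /=; lia.
move=> [x y]; rewrite mem_enum !inE /=.
move: ab bc ac; rewrite /o -!val_eqE /=.
by do 3 case: ifP => ?; rewrite !xpair_eqE -!val_eqE /=; lia.
Qed.

Lemma all_iota3 n (P : nat -> nat -> nat -> bool) :
  all (fun i => all (fun j => all (P i j) (iota 0 n)) (iota 0 n)) (iota 0 n) ->
  forall i j k : 'I_n, P i j k.
Proof.
move=> aP i j k.
by apply: (allP (allP (allP aP i _) j _) k); rewrite mem_iota ltn_ord.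
Qed.

Definition weight_sum3 (w : nat -> nat -> int) i j k := w i j + w j k + w i k.

(** The relation that [weight_triangle] establishes between [weight X] and [X], for weights given on
    the labels. *)
Definition selects (w : nat -> nat -> int) (Q : {set triple}) :=
  forall (x : triple) (a b c : 'I_10), a != b -> b != c -> a != c ->
  val x = c |: [set a; b] -> weight_sum3 w a b c = if x \in Q then 3 else -3.

(** Reduces [selects] to a computation over all label triples. *)
Lemma selects_dists (w : nat -> nat -> int) (ds : seq (seq nat)) (Q : {set triple}) :
  all (fun i => all (fun j => all (fun k => [|| i == j, j == k, i == k |
      weight_sum3 w i j k == if has (perm_eq (dists3 i j k)) ds then 3 else -3])
    (iota 0 10)) (iota 0 10)) (iota 0 10) ->
  (forall x, (x \in Q) = has (perm_eq (cycle_dists (val x))) ds) ->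
  selects w Q.
Proof.
move=> /(@all_iota3 10 (fun i j k => [|| i == j, j == k, i == k | _ == _])) wds QE.
move=> x a b c ab bc ac xE; have := wds a b c.
rewrite (negbTE (ab : a != b :> nat)) (negbTE (bc : b != c :> nat)).
rewrite (negbTE (ac : a != c :> nat)) QE xE => /eqP ->.
congr (if _ then _ else _); apply: eq_has => s.
by rewrite (permPl (cycle_dists_set3 ab bc ac)).
Qed.

Lemma P1_selects : selects matching_weight P1.
Proof.
apply: (@selects_dists _ [:: [:: 1; 1; 2]; [:: 1; 2; 3]; [:: 1; 3; 4]; [:: 3; 3; 4]]%N).
  by vm_compute.
by move=> x; rewrite !inE /= orbF -!orbA.
Qed.

Lemma P2_selects : selects (fun i j => - matching_weight i j) P2.
Proof.
apply: (@selects_dists _ [:: [:: 1; 4; 5]; [:: 2; 2; 4]; [:: 2; 3; 5]; [:: 2; 4; 4]]%N).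
  by vm_compute.
by move=> x; rewrite !inE /= orbF -!orbA.
Qed.

Lemma P1'_selects : selects pentagon_weight P1'.
Proof.
apply: (@selects_dists _ [:: [:: 1; 3; 4]; [:: 1; 4; 5]; [:: 2; 4; 4]; [:: 3; 3; 4]]%N).
  by vm_compute.
by move=> x; rewrite !inE /= orbF -!orbA.
Qed.

Lemma P2'_selects : selects (fun i j => - pentagon_weight i j) P2'.
Proof.
apply: (@selects_dists _ [:: [:: 1; 1; 2]; [:: 1; 2; 3]; [:: 2; 2; 4]; [:: 2; 3; 5]]%N).
  by vm_compute.
by move=> x; rewrite !inE /= orbF -!orbA.
Qed.

(** Opposite weights have opposite triangle sums. This yields that the two parts of each model
    partition are complementary. *)
Lemma selects_opp_setC w Q Q' :
  selects w Q -> selects (fun i j => - w i j) Q' -> Q' = ~: Q.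
Proof.
move=> wQ wQ'; apply/setP=> x; rewrite inE.
have [a [b [c [ab bc ac xE]]]] := triple_set3 x.
have := wQ x a b c ab bc ac xE; have := wQ' x a b c ab bc ac xE.
by rewrite /weight_sum3; case: (x \in Q); case: (x \in Q') => //; lia.
Qed.

(** * Permutations of the points acting on triples *)

Section TripleAction.
Variables (g : 'I_10 -> 'I_10) (g_inj : injective g).

Lemma card_triple_image (x : triple) : #|g @: val x| == 3%N.
Proof. by rewrite card_imset //; case: x. Qed.

Definition triple_image (x : triple) : triple :=
  exist (fun s : {set 'I_10} => #|s| == 3%N) (g @: val x) (card_triple_image x).

Lemma triple_image_inj : injective triple_image.
Proof. by move=> x y /(congr1 val) /= /(imset_inj g_inj) /val_inj. Qed.

Definition triple_perm : {perm triple} := perm triple_image_inj.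

Lemma triple_perm_automorphism : graph_automorphism johnson_adj triple_perm.
Proof.
move=> x y; rewrite /johnson_adj !permE /= -imsetI ?card_imset //.
by move=> ? ? _ _; apply: g_inj.
Qed.

(** A triple has the same weight sum under [w] as its image has under [weight X], and the sign of
    this sum decides both memberships. *)
Lemma preim_triple_perm_selects (X Q : {set triple}) (w : nat -> nat -> int) :
  (forall a b c, a != b -> b != c -> a != c ->
    weight X a b + weight X b c + weight X a c =
    if hyperedge X (c |: [set a; b]) then 3 else -3) ->
  (forall i j : 'I_10, i != j -> weight X (g i) (g j) = w i j) ->
  selects w Q -> triple_perm @^-1: X = Q.
Proof.
move=> wX wg wQ; apply/setP=> x; rewrite inE permE.
have [a [b [c [ab bc ac xE]]]] := triple_set3 x.
have := wX (g a) (g b) (g c); rewrite !(inj_eq g_inj) => /(_ ab bc ac).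
rewrite !wg // -[_ + _ + _]/(weight_sum3 w a b c) (wQ x a b c ab bc ac xE).
have -> : g c |: [set g a; g b] = val (triple_image x).
  by rewrite /= xE imsetU1 imsetU1 imset_set1.
by rewrite hyperedge_val; do 2 case: (_ \in _).
Qed.

End TripleAction.

Lemma isomorphic_partitions_preim (T : finType) (e : rel T) (f : {perm T})
    (X Q : {set T}) : graph_automorphism e f -> f @^-1: X = Q ->
  isomorphic_partitions e [set X; ~: X] [set Q; ~: Q].
Proof.
(* Since [f] carries [Q] onto [X], the required map is its inverse. *)
move=> ef <-; exists f^-1%g => [x y|]; first by rewrite -ef !permKV.
by rewrite imsetU1 imset_set1 !im_permV preimsetC.
Qed.

Theorem mainTheorem4 (X1 X2 : {set triple}) :
  perfect_2coloring johnson_adj quotient_matrix X1 X2 ->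
  isomorphic_partitions johnson_adj [set X1; X2] [set P1; P2] \/
  isomorphic_partitions johnson_adj [set X1; X2] [set P1'; P2'].
Proof.
case=> X12 dX12 pX.
have X2E : X2 = ~: X1.
  apply/setP=> x; rewrite inE; have /setP/(_ x) := X12; rewrite !inE.
  by case: (boolP (x \in X1)) => //= /(disjointFr dX12).
have nbX (x : triple) :
    #|[set y in X1 | johnson_adj x y]| = if x \in X1 then 12%N else 9%N.
  case: ifPn => xX; first by rewrite (pX ord0 ord0) // mxE.
  by rewrite (pX ord_max ord0 x) ?mxE //= X2E inE.
have wX := weight_triangle nbX.
have [|||||g g_inj wg] := @weight_classification 'I_10 (weight X1).
- by rewrite card_ord.
- exact: weightC.
- exact: weight_bound.
- by move=> a b c ab bc ac; rewrite wX //; case: ifP; [left | right].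
- exact: weight_row.
have P2E := selects_opp_setC P1_selects P2_selects.
have P2'E := selects_opp_setC P1'_selects P2'_selects.
have aut := triple_perm_automorphism g_inj.
rewrite X2E P2'E; case: wg => wg; [right | left | left].
- exact: isomorphic_partitions_preim aut (preim_triple_perm_selects g_inj wX wg P1'_selects).
- rewrite P2E.
  exact: isomorphic_partitions_preim aut (preim_triple_perm_selects g_inj wX wg P1_selects).
(* The opposite of [matching_weight] selects [P2], so [X1] is sent to [P2] and the parts are
   exchanged. *)
rewrite [[set P1; P2]]setUC (_ : P1 = ~: P2); last by rewrite P2E setCK.
exact: isomorphic_partitions_preim aut (preim_triple_perm_selects g_inj wX wg P2_selects).
Qed.
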